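(* Let $(\theta_n)_{n\ge1}$ be a nondecreasing sequence of positive real numbers and write $\theta=\theta_n$. As $n\to\infty$, $$\| F_{n,\theta} - \Phi \|_\infty \asymp \begin{cases} 1/\sqrt{\theta\log(n/\theta)} & \text{in Case A},\\ 1/\sqrt{\theta} & \text{in Case B}^\star,\\ 1/\sqrt{n^2/\theta} & \text{in Case C1}.\end{cases}$$
   Context: For $\theta>0$ and a positive integer $n$, let $K=K_{n,\theta}$ be a random variable with ${\rm P}(K=x)=\bar{s}(n,x)\theta^x/(\theta)_n$ for $x=1,\ldots,n$, where $(\theta)_n=\theta(\theta+1)\cdots(\theta+n-1)$ and $\bar{s}(n,x)$ is the coefficient of $\theta^x$ in $(\theta)_n$ viewed as a polynomial in $\theta$. Let $\mu_0={\rm E}[K]=\theta\sum_{i=1}^n \frac{1}{\theta+i-1}$ and $\sigma_0^2={\rm var}(K)=\theta\sum_{i=1}^n\frac{i-1}{(\theta+i-1)^2}$. $F_{n,\theta}$ is the distribution function of $X_{n,\theta}=(K-\mu_0)/\sigma_0$, $\Phi$ is the standard normal distribution function, and $\|f\|_\infty=\sup_{x\in\mathbb{R}}|f(x)|$. The parameter $\theta=\theta_n$ may depend on $n$ and is nondecreasing in $n$ (constant $\theta$ allowed). For positive sequences, $a_n\asymp b_n$ means that $a_n/b_n$ is bounded above and bounded away from $0$ for all sufficiently large $n$. Let $c^\star$ be the unique positive root of $\log(1+x)-2+\frac{3}{x+1}-\frac{1}{(x+1)^2}=0$ (numerically $c^\star=2.16258\cdots$). Asymptotic regimes as $n\to\infty$: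 Case A: $n/\theta\to\infty$. Case B$^\star$: $n/\theta\to c$ for some $0<c<\infty$ with $c\ne c^\star$. Case C1: $n/\theta\to0$ and $n^2/\theta\to\infty$. *)

(* Defs.v *)
From HB Require Import structures.
From mathcomp Require Export all_boot all_order all_algebra.
From mathcomp Require Export all_classical all_reals all_analysis measurable_realfun.
From mathcomp Require Import ring lra.
Export Order.TTheory GRing.Theory Num.Theory.
Export numFieldNormedType.Exports.

Set Implicit Arguments.
Unset Strict Implicit.
Unset Printing Implicit Defensive.

Local Open Scope classical_set_scope.
Local Open Scope ring_scope.

Definition rising_poly (R : realType) (n : nat) : {poly R} :=
  \prod_(i < n) ('X + (i%:R)%:P).

(* For 0 < n these masses add up to 1, since the constant coefficient of
   [rising_poly R n] is then 0; so they determine the law of [K]. *)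
Definition ewens_K_law (R : realType) (d : measure_display)
    (T : measurableType d) (P : probability T R) (n : nat) (theta : R)
    (K : {RV P >-> R}) : Prop :=
  forall x : nat, (1 <= x <= n)%N ->
    P [set w | K w = x%:R] =
      ((rising_poly R n)`_x * theta ^+ x / (rising_poly R n).[theta])%:E.

Section standardized.
Context (R : realType) (d : measure_display) (T : measurableType d).
Context (P : probability T R).

Definition mean (K : {RV P >-> R}) : R := fine 'E_P[K].

Definition stddev (K : {RV P >-> R}) : R := Num.sqrt (fine (variance P K)).

Definition standardize (K : {RV P >-> R}) (w : T) : R :=
  (K w - mean K) / stddev K.

Lemma measurable_standardize (K : {RV P >-> R}) :
  measurable_fun [set: T] (standardize K).
Proof.
apply: measurable_funM; last exact: measurable_cst.
by apply: measurable_funB; [exact: measurable_funPT|exact: measurable_cst].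
Qed.

HB.instance Definition _ (K : {RV P >-> R}) :=
  isMeasurableFun.Build _ _ T R (standardize K) (measurable_standardize K).

Definition standardized_cdf (K : {RV P >-> R}) (x : R) : R :=
  fine (cdf (standardize K : {RV P >-> R}) x).

End standardized.

Definition std_normal_cdf (R : realType) (x : R) : R :=
  fine (normal_prob (0 : R) 1 `]-oo, x]).

Definition sup_norm (R : realType) (f : R -> R) : R :=
  sup (range (fun x => `|f x|)).

Definition cstar_eqn (R : realType) (x : R) : R :=
  ln (1 + x) - 2 + 3 / (x + 1) - 1 / (x + 1) ^+ 2.

Definition cstar (R : realType) : R :=
  get [set x : R | 0 < x /\ cstar_eqn x = 0].

Section cstar_well_defined.
Variable R : realType.
Implicit Types x y : R.

Let is_derive_cstar_eqn x : -1 < x ->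
  is_derive x 1 (@cstar_eqn R) (x * (x - 1) / (x + 1) ^+ 3).
Proof.
move=> x0.
have x1 : 0 < 1 + x by lra.
have x1' : x + 1 != 0 by lra.
have dl : is_derive x 1 (fun y : R => ln (1 + y)) ((1 + x)^-1 * (0 + 1)).
  by apply: is_derive1_comp (is_derive1_ln x1) _; exact: is_deriveD.
have dv : is_derive x 1 (fun y : R => (y + 1)^-1) (- (x + 1) ^- 2 *: (1 + 0)).
  by apply: is_deriveV => //; exact: is_deriveD.
have -> : @cstar_eqn R = (fun y : R => ln (1 + y)) - cst 2
    + 3 *: (fun y : R => (y + 1)^-1) - (fun y : R => (y + 1)^-1) ^+ 2.
  by apply/funext => y; rewrite /cstar_eqn/= div1r -exprVn.
apply: is_derive_eq.
rewrite /GRing.scale/= (addrC 1 x); field; exact: x1'.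
Qed.

Let continuous_cstar_eqn x y : 0 <= x -> {within `[x, y], continuous (@cstar_eqn R)}.
Proof.
move=> x0; apply: derivable_within_continuous => z.
rewrite in_itv/= => /andP[xz _].
by apply: ex_derive; apply: is_derive_cstar_eqn; lra.
Qed.

Let cstar_eqn_lt0 x : 0 < x <= 1 -> cstar_eqn x < 0.
Proof.
move=> /andP[x0 x1].
have e0 : @cstar_eqn R 0 = 0 by rewrite /cstar_eqn addr0 ln1; field.
rewrite -e0.
apply: (@ltr0_derive1_decr R (@cstar_eqn R) 0 1) => //.
- move=> z; rewrite in_itv/= => /andP[z0 _].
  by apply: ex_derive; apply: is_derive_cstar_eqn; lra.
- move=> z; rewrite in_itv/= => /andP[z0 z1].
  have dz : is_derive z 1 (@cstar_eqn R) (z * (z - 1) / (z + 1) ^+ 3).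
    by apply: is_derive_cstar_eqn; lra.
  rewrite derive1E derive_val mulrAC -mulrA pmulr_rlt0//.
  by rewrite pmulr_rlt0 ?subr_lt0// invr_gt0 exprn_gt0//; lra.
- exact: continuous_cstar_eqn.
Qed.

Let cstar_eqn_incr x y : 1 <= x -> x < y -> cstar_eqn x < cstar_eqn y.
Proof.
move=> x1 xy.
apply: (@gtr0_derive1_incr R (@cstar_eqn R) 1 y) => //.
- move=> z; rewrite in_itv/= => /andP[z1 _].
  by apply: ex_derive; apply: is_derive_cstar_eqn; lra.
- move=> z; rewrite in_itv/= => /andP[z1 _].
  have dz : is_derive z 1 (@cstar_eqn R) (z * (z - 1) / (z + 1) ^+ 3).
    by apply: is_derive_cstar_eqn; lra.
  rewrite derive1E derive_val divr_gt0 ?mulr_gt0 ?exprn_gt0//; lra.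
- exact: continuous_cstar_eqn.
Qed.

Lemma cstar_unique_pos_root : exists! x : R, 0 < x /\ cstar_eqn x = 0.
Proof.
have e2 : 3 <= expR 2 :> R by apply: le_trans (expR_ge1Dx 2); lra.
have h1 : @cstar_eqn R 1 < 0 by apply: cstar_eqn_lt0; rewrite ltr01 lexx.
have h2 : 0 < cstar_eqn (expR 2 - 1 : R).
  rewrite /cstar_eqn (addrC 1) subrK expRK subrr add0r.
  have -> : 3 / expR 2 - 1 / expR 2 ^+ 2 =
      (3 * expR 2 - 1) / expR 2 ^+ 2 :> R.
    by field; rewrite gt_eqF// expR_gt0.
  by rewrite divr_gt0 ?exprn_gt0 ?expR_gt0//; lra.
have [|||c] := @IVT R (@cstar_eqn R) 1 (expR 2 - 1) 0.
- by lra.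
- exact: continuous_cstar_eqn.
- by rewrite ge_min le_max (ltW h1) (ltW h2) orbT.
rewrite in_itv/= => /andP[c1 _] hc; exists c; split; first by split => //; lra.
have large (z : R) : 0 < z -> cstar_eqn z = 0 -> 1 <= z.
  move=> z0 hz; case: (leP 1 z) => // z1.
  by have := @cstar_eqn_lt0 z; rewrite z0 ltW// hz ltxx => /(_ isT).
move=> y [y0 hy]; have y1 := large _ y0 hy.
case: (ltgtP c y) => // yc.
- by have := cstar_eqn_incr c1 yc; rewrite hc hy ltxx.
- by have := cstar_eqn_incr y1 yc; rewrite hc hy ltxx.
Qed.

Lemma cstarP : 0 < cstar R /\ cstar_eqn (cstar R) = 0.
Proof.
have [c [c0 _]] := cstar_unique_pos_root.
exact: (@getPex _ [set x : R | 0 < x /\ cstar_eqn x = 0] (ex_intro _ c c0)).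
Qed.

End cstar_well_defined.

Definition asymp (R : realType) (a b : nat -> R) : Prop :=
  exists m M : R, 0 < m /\ \forall n \near \oo, m <= a n / b n <= M.

Definition caseA (R : realType) (theta : nat -> R) : Prop :=
  n%:R / theta n @[n --> \oo] --> +oo.

Definition caseBstar (R : realType) (theta : nat -> R) : Prop :=
  exists2 c : R, 0 < c /\ c <> cstar R & n%:R / theta n @[n --> \oo] --> c.

Definition caseC1 (R : realType) (theta : nat -> R) : Prop :=
  n%:R / theta n @[n --> \oo] --> (0 : R) /\
  n%:R ^+ 2 / theta n @[n --> \oo] --> +oo.

(* Main.v *)
(* The upper bounds come from Stein's method and the lower bounds from the fact
   that [K] is integer valued; together they show that the distance is of order
   1/sigma as soon as the variance sigma^2 of [K] is at least 1.

   [K] is distributed as a sum of independent Bernoulli variables with parameters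
   p_i = theta / (theta + i), i < n.  Conditioning on one summand at a time gives
     E [(K - mu) f(K)] >= sigma^2 E [l(K)]
   whenever the increments f(x+1) - f(x) dominate both l(x) and l(x+1).  Put
   W = (K - mu) / sigma and let f be the solution of
   f'(w) - w f(w) = 1_(w <= z) - Phi(z): as w f(w) is Lipschitz with constant
   O(1 + |w|), the increment of f over a step 1/sigma is, up to O((1 + |w|)/sigma^2),
   (w f(w) + 1_(w <= z -+ 1/sigma) - Phi(z)) / sigma, and the terms E [W f(W)]
   cancel.  Conversely the distribution function of W is constant between
   consecutive points of a lattice of mesh 1/sigma, whereas Phi grows by at least
   a constant times 1/sigma there.

   Finally sigma^2 is compared with theta log (n/theta), theta and n^2/theta. *)
From HB Require Import structures.
Require Import Defs.
From mathcomp Require Import ring lra.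

Set Implicit Arguments.
Unset Strict Implicit.
Unset Printing Implicit Defensive.

Local Open Scope classical_set_scope.
Local Open Scope ring_scope.

(** * The standard normal density and distribution function *)

Section normal.
Variable R : realType.
Implicit Types w x y z : R.

Local Notation phi := (@normal_pdf R 0 1).
Local Notation Phi := (@std_normal_cdf R).

Lemma normal_pdf01E w : phi w = normal_peak 1 * expR (- (w ^+ 2 / 2)).
Proof.
rewrite normal_pdfE ?oner_neq0// /normal_fun subr0 expr1n.
by rewrite mulNr.
Qed.

Lemma normal_pdf01_gt0 w : 0 < phi w.
Proof. by rewrite normal_pdf01E mulr_gt0 ?expR_gt0// normal_peak_gt0 ?oner_neq0. Qed.

Lemma normal_peak1_le1 : normal_peak 1 <= 1 :> R.
Proof.
rewrite /normal_peak invf_le1 ?sqrtr_gt0; last first.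
  by rewrite expr1n mul1r mulrn_wgt0// pi_gt0.
rewrite -[leLHS]sqrtr1 ler_sqrt expr1n mul1r; last by rewrite mulrn_wge0 ?pi_ge0.
have := @pi_ge2 R; lra.
Qed.

Lemma normal_pdf01_le1 w : phi w <= 1.
Proof. exact: le_trans (normal_pdf_ub _ _ (oner_neq0 _)) normal_peak1_le1. Qed.

Lemma normal_pdf01_ge w : `|w| <= 1 -> phi 1 <= phi w.
Proof.
move=> w1; rewrite !normal_pdf01E ler_pM2l ?normal_peak_gt0 ?oner_neq0//.
by rewrite ler_expR lerN2 ler_pM2r// expr1n -real_normK ?num_real// expr_le1.
Qed.

Lemma is_derive_normal_pdf01 w : is_derive w 1 phi (- w * phi w).
Proof.
have -> : phi = (normal_peak 1) \*: (expR \o (fun x => - (2^-1 *: (x ^+ 2)))).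
  apply/funext => x; rewrite normal_pdf01E/= /GRing.scale/=.
  by rewrite [_ / 2]mulrC.
apply: is_derive_eq; rewrite /= /GRing.scale/= -?mulr_regl /=.
by field.
Qed.

Lemma is_derive_std_normal_cdf w : is_derive w 1 Phi (phi w).
Proof.
have -> : Phi = fun y => (\int[lebesgue_measure]_(t in `]-oo, y]) phi t)%R.
  by [].
have [|||d1 d2] := @continuous_FTC1 R phi -oo%O w (w + 1) _ _ _
  (@continuous_normal_pdf _ _ _ (oner_neq0 _) w).
- by rewrite ltrDl.
- apply: integrableS (integrable_normal_pdf _ _) => //.
- by rewrite ltNyr.
by apply: DeriveDef => //; rewrite -derive1E d2.
Qed.

Lemma std_normal_cdf_ge0 x : 0 <= Phi x.
Proof. by rewrite /std_normal_cdf fine_ge0. Qed.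

Lemma std_normal_cdf_le1 x : Phi x <= 1.
Proof.
rewrite /std_normal_cdf -[leRHS]/(fine 1%E) fine_le ?fin_num_measure//.
exact: probability_le1.
Qed.

(** The identity as a random variable under the normal law: its distribution function is [Phi], so
    the limits at infinity come from those of a general [cdf]. *)
Definition normal_id : measurableTypeR R -> R := idfun.

#[local] HB.instance Definition _ :=
  @isMeasurableFun.Build _ _ _ _ normal_id (@measurable_id _ _ setT).

Lemma std_normal_cdf_cvg : (Phi x @[x --> +oo] --> (1 : R)) /\
  (Phi x @[x --> -oo] --> (0 : R)).
Proof.
pose X : {RV (normal_prob (0 : R) 1) >-> R} := normal_id.
by split; apply: fine_cvg; [exact: (cvg_cdfy1 X)|exact: (cvg_cdfNy0 X)].
Qed.

End normal.

(** * Mean value inequalities, also for functions glued from two smooth pieces *)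

Section mean_value.
Variable R : realType.
Implicit Types (a b x z m : R).

Lemma mvt_ge (f df : R -> R) a b m :
  (forall x : R, is_derive x 1 f (df x)) -> a <= b ->
  (forall x, a < x < b -> m <= df x) -> m * (b - a) <= f b - f a.
Proof.
move=> fd; rewrite le_eqVlt => /predU1P[->|ab] h.
  by rewrite !subrr mulr0.
have [|x xab ->] := MVT ab (fun x _ => fd x).
  by apply: derivable_within_continuous => x _; exact: ex_derive.
rewrite ler_wpM2r//; first by rewrite subr_ge0 ltW.
apply: h.
by move: xab; rewrite in_itv.
Qed.

(** Serves functions with a kink at [z], such as the solution of Stein's equation: an interval that
    contains [z] is split there, and each smooth piece is handled by [mvt_ge]. *)
Lemma piecewise_mvt_ge (f f1 f2 df1 df2 : R -> R) z a b m :
  (forall x : R, is_derive x 1 f1 (df1 x)) ->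
  (forall x : R, is_derive x 1 f2 (df2 x)) ->
  (forall x, x <= z -> f x = f1 x) -> (forall x, z <= x -> f x = f2 x) ->
  a <= b ->
  (forall x, a < x < b -> x < z -> m <= df1 x) ->
  (forall x, a < x < b -> z < x -> m <= df2 x) ->
  m * (b - a) <= f b - f a.
Proof.
move=> d1 d2 e1 e2 ab h1 h2.
have [bz|zb] := leP b z.
  rewrite !e1//; last exact: le_trans ab bz.
  apply: (mvt_ge d1) => // x /andP[ax xb].
  by apply: h1; rewrite ?ax// (lt_le_trans xb).
have [za|az] := leP z a.
  rewrite !e2//; last exact: ltW.
  apply: (mvt_ge d2) => // x /andP[ax xb].
  by apply: h2; rewrite ?ax// (le_lt_trans za).
have H1 : m * (z - a) <= f z - f a.
  rewrite (e1 z)// (e1 a) ?(ltW az)//; apply: (mvt_ge d1); first exact: ltW.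
  by move=> x /andP[ax xz]; apply: h1; rewrite ?ax//= (lt_trans xz).
have H2 : m * (b - z) <= f b - f z.
  rewrite (e2 z)// (e2 b) ?(ltW zb)//; apply: (mvt_ge d2); first exact: ltW.
  by move=> x /andP[zx xb]; apply: h2; rewrite ?xb ?andbT//= (lt_trans az).
lra.
Qed.

Lemma piecewise_mvt_le (f f1 f2 df1 df2 : R -> R) z a b m :
  (forall x : R, is_derive x 1 f1 (df1 x)) ->
  (forall x : R, is_derive x 1 f2 (df2 x)) ->
  (forall x, x <= z -> f x = f1 x) -> (forall x, z <= x -> f x = f2 x) ->
  a <= b ->
  (forall x, a < x < b -> x < z -> df1 x <= m) ->
  (forall x, a < x < b -> z < x -> df2 x <= m) ->
  f b - f a <= m * (b - a).
Proof.
move=> d1 d2 e1 e2 ab h1 h2.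
have : - m * (b - a) <= (- f) b - (- f) a; last by rewrite !fctE; lra.
apply: (@piecewise_mvt_ge (- f) (- f1) (- f2) (- df1) (- df2) z) => //.
- by move=> x xz; rewrite !fctE e1.
- by move=> x xz; rewrite !fctE e2.
- by move=> x xab xz; rewrite !fctE lerN2 h1.
- by move=> x xab xz; rewrite !fctE lerN2 h2.
Qed.

End mean_value.

(** * Mills ratios and Gaussian tail bounds *)

Section mills.
Variable R : realType.
Implicit Types w x y z : R.

Local Notation phi := (@normal_pdf R 0 1).
Local Notation Phi := (@std_normal_cdf R).

Lemma std_normal_cdf_mono x y : x <= y -> Phi x <= Phi y.
Proof.
move=> xy; rewrite -subr_ge0 -(mul0r (y - x)).
apply: (mvt_ge (@is_derive_std_normal_cdf R)) => // t _.
by rewrite ltW// normal_pdf01_gt0.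
Qed.

Lemma std_normal_cdf_lip x y : x <= y -> Phi y - Phi x <= y - x.
Proof.
move=> xy; rewrite -(mul1r (y - x)).
apply: (piecewise_mvt_le (z := x) (@is_derive_std_normal_cdf R)
  (@is_derive_std_normal_cdf R)) => // t _ _; exact: normal_pdf01_le1.
Qed.

(** The Mills ratios of the right and left tails; they solve [y' = w y - 1] and [y' = w y + 1], and
    multiples of them are the two pieces of the Stein solution. *)
Definition mills_r w := (1 - Phi w) / phi w.
Definition mills_l w := Phi w / phi w.

Lemma is_derive_mills_r w : is_derive w 1 mills_r (w * mills_r w - 1).
Proof.
have p0 : phi w != 0 by rewrite gt_eqF// normal_pdf01_gt0.
have d1 := is_derive_std_normal_cdf w.
have d2 := is_derive_normal_pdf01 w.
have -> : mills_r = (cst 1 - Phi) * (fun x => (phi x)^-1) by [].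
have d3 := is_deriveV p0 d2.
apply: is_derive_eq; rewrite /GRing.scale/= !fctE /mills_r.
by field.
Qed.

Lemma is_derive_mills_l w : is_derive w 1 mills_l (w * mills_l w + 1).
Proof.
have p0 : phi w != 0 by rewrite gt_eqF// normal_pdf01_gt0.
have d1 := is_derive_std_normal_cdf w.
have d2 := is_derive_normal_pdf01 w.
have -> : mills_l = Phi * (fun x => (phi x)^-1) by [].
have d3 := is_deriveV p0 d2.
apply: is_derive_eq; rewrite /GRing.scale/= !fctE /mills_l.
by field.
Qed.

Lemma is_derive_phi_div w : w != 0 ->
  is_derive w 1 (fun x => phi x / x) (- phi w - phi w / w ^+ 2).
Proof.
move=> w0.
have d2 := is_derive_normal_pdf01 w.
have -> : (fun x => phi x / x) = phi * (fun x => (id x)^-1) by [].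
have d3 := is_deriveV w0 (is_derive_id w 1).
apply: is_derive_eq; rewrite /GRing.scale/=.
by field.
Qed.

(** The function [Phi x + phi x / x] has derivative [- phi x / x ^+ 2], so it decreases on the
    positive axis towards 1. A far point [t] with [1 - Phi t < e] replaces the limit. *)
Lemma mills_r_le w : 0 < w -> w * (1 - Phi w) <= phi w.
Proof.
move=> w0; rewrite mulrC -ler_pdivlMr//; apply/ler_addgt0Pr => e e0.
have [t [wt te]] : exists t, w < t /\ 1 - Phi t < e.
  have [/cvgrPdist_lt/(_ e e0) H _] := std_normal_cdf_cvg R.
  near (+oo : set_system R) => t; exists t; split.
    by near: t; exact: nbhs_pinfty_gt (num_real _).
  by apply: le_lt_trans (ler_norm _) _; near: t.
have h : 0 <= (Phi w + phi w / w) - (Phi t + phi t / t).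
  have d x : x \in `]w, t[ ->
      is_derive x 1 (Phi + (fun x => phi x / x)) (- (phi x / x ^+ 2)).
    rewrite in_itv/= => /andP[wx _].
    have d1 := is_derive_std_normal_cdf x.
    have d2 := @is_derive_phi_div x (lt0r_neq0 (lt_trans w0 wx)).
    apply: is_derive_eq; ring.
  have [|x] := MVT wt d.
    apply: derivable_within_continuous => x; rewrite in_itv/= => /andP[wx _].
    have d1 := is_derive_std_normal_cdf x.
    have d2 := @is_derive_phi_div x (lt0r_neq0 (lt_le_trans w0 wx)).
    exact: ex_derive.
  rewrite in_itv/= => /andP[wx _] e1.
  rewrite -oppr_le0 opprB.
  rewrite -[X in X <= _]/((Phi + (fun x => phi x / x)) t -
    (Phi + (fun x => phi x / x)) w).
  rewrite e1 mulNr oppr_le0 mulr_ge0//; last by rewrite subr_ge0 ltW.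
  by rewrite divr_ge0 ?sqr_ge0// ltW// normal_pdf01_gt0.
have : 0 < phi t / t by rewrite divr_gt0 ?normal_pdf01_gt0// (lt_trans w0).
lra.
Unshelve. all: by end_near. Qed.

(** The function [Phi x + phi x / x] also decreases on the negative axis, starting from the limit 0
    at minus infinity. *)
Lemma mills_l_le w : w < 0 -> - w * Phi w <= phi w.
Proof.
move=> w0; rewrite mulrC -ler_pdivlMr ?oppr_gt0//; apply/ler_addgt0Pr => e e0.
have [t [wt te]] : exists t, t < w /\ Phi t < e.
  have [_ /cvgrPdist_lt/(_ e e0) H] := std_normal_cdf_cvg R.
  near (-oo : set_system R) => t; exists t; split.
    by near: t; exact: nbhs_ninfty_lt (num_real _).
  apply: le_lt_trans (ler_norm _) _; rewrite -normrN -sub0r; near: t; exact: H.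
have h : (Phi w + phi w / w) - (Phi t + phi t / t) <= 0.
  have d x : x \in `]t, w[ ->
      is_derive x 1 (Phi + (fun x => phi x / x)) (- (phi x / x ^+ 2)).
    rewrite in_itv/= => /andP[_ wx].
    have d1 := is_derive_std_normal_cdf x.
    have d2 := @is_derive_phi_div x (ltr0_neq0 (lt_trans wx w0)).
    apply: is_derive_eq; ring.
  have [|x] := MVT wt d.
    apply: derivable_within_continuous => x; rewrite in_itv/= => /andP[_ wx].
    have d1 := is_derive_std_normal_cdf x.
    have d2 := @is_derive_phi_div x (ltr0_neq0 (le_lt_trans wx w0)).
    exact: ex_derive.
  rewrite in_itv/= => /andP[_ wx] e1.
  rewrite -[X in X <= _]/((Phi + (fun x => phi x / x)) w -
    (Phi + (fun x => phi x / x)) t).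
  rewrite e1 mulNr oppr_le0 mulr_ge0//; last by rewrite subr_ge0 ltW.
  by rewrite divr_ge0 ?sqr_ge0// ltW// normal_pdf01_gt0.
have : phi t / t < 0.
  by rewrite pmulr_rlt0 ?normal_pdf01_gt0// invr_lt0 (lt_trans wt).
rewrite invrN mulrN; lra.
Unshelve. all: by end_near. Qed.

End mills.

(** * The solution of Stein's equation and its increments *)

Section stein.
Variable R : realType.
Implicit Types a b w x y z : R.

Local Notation phi := (@normal_pdf R 0 1).
Local Notation Phi := (@std_normal_cdf R).
Local Notation mills_l := (@mills_l R).
Local Notation mills_r := (@mills_r R).

(** This is [stein_sol w w], the largest value of [stein_sol z w] over all [z]; bounds on it are
    therefore uniform in [z]. *)
Definition mills_env w := Phi w * (1 - Phi w) / phi w.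

Lemma mills_env_ge0 w : 0 <= mills_env w.
Proof.
rewrite divr_ge0 ?mulr_ge0 ?std_normal_cdf_ge0 ?subr_ge0 ?std_normal_cdf_le1//.
by rewrite ltW// normal_pdf01_gt0.
Qed.

(** The tail bound on the side of the sign of [w] controls one of the factors [Phi w], [1 - Phi w];
    the other is at most 1. *)
Lemma mills_env_norm w : `|w| * mills_env w <= 1.
Proof.
have P0 := std_normal_cdf_ge0 w; have P1 := std_normal_cdf_le1 w.
rewrite mulrA ler_pdivrMr ?normal_pdf01_gt0// mul1r.
have [w0|w0|->] := ltrgt0P w.
- rewrite mulrCA; apply: le_trans (mills_r_le w0).
  by rewrite ler_piMl// mulr_ge0 ?subr_ge0// ltW.
- rewrite mulrA; apply: le_trans (mills_l_le w0).
  by rewrite ler_piMr ?mulr_ge0 ?oppr_ge0 ?(ltW w0)// gerBl.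
- by rewrite mul0r ltW// normal_pdf01_gt0.
Qed.

(** For [|w| <= 1] the density is at least [phi 1]; for larger [|w|] the previous bound already
    gives 1. *)
Lemma mills_env_ub w : mills_env w <= (phi 1)^-1.
Proof.
have P0 := std_normal_cdf_ge0 w; have P1 := std_normal_cdf_le1 w.
have [w1|w1] := leP `|w| 1.
  apply: (@le_trans _ _ (phi w)^-1).
    rewrite -[leRHS]mul1r ler_wpM2r ?invr_ge0 ?(ltW (normal_pdf01_gt0 _))//.
    by rewrite mulr_ile1 ?subr_ge0// gerBl.
  by rewrite lef_pV2 ?posrE ?normal_pdf01_gt0// normal_pdf01_ge.
apply: (@le_trans _ _ 1); last by rewrite invf_ge1 ?normal_pdf01_gt0 ?normal_pdf01_le1.
apply: le_trans (mills_env_norm w).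
by rewrite ler_peMl ?mills_env_ge0// ltW.
Qed.

(* The bounded solution of [f'(w) - w f(w) = 1_(w <= z) - Phi z]. *)
Definition stein_sol z w :=
  if w <= z then (1 - Phi z) * mills_l w else Phi z * mills_r w.

Lemma stein_solL z w : w <= z -> stein_sol z w = (1 - Phi z) * mills_l w.
Proof. by rewrite /stein_sol => ->. Qed.

(** The two branches agree at [z], so each formula holds on a closed half-line, as the piecewise
    mean value inequalities require. *)
Lemma stein_solR z w : z <= w -> stein_sol z w = Phi z * mills_r w.
Proof.
rewrite /stein_sol le_eqVlt => /predU1P[->|].
  by rewrite lexx /mills_l /mills_r mulrCA mulrA mulrC mulrA.
by rewrite ltNge => /negbTE ->.
Qed.

Lemma stein_sol_ge0 z w : 0 <= stein_sol z w.
Proof.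
have p := ltW (normal_pdf01_gt0 w).
rewrite /stein_sol; case: ifP => _; rewrite mulr_ge0 ?divr_ge0 ?subr_ge0//.
all: by rewrite ?std_normal_cdf_le1 ?std_normal_cdf_ge0.
Qed.

Lemma stein_sol_le_env z w : stein_sol z w <= mills_env w.
Proof.
have p := normal_pdf01_gt0 w.
rewrite /stein_sol /mills_env; case: ifPn => [wz|]; rewrite mulrA ler_pM2r ?invr_gt0//.
  rewrite mulrC ler_wpM2l ?std_normal_cdf_ge0// lerD2l lerN2.
  exact: std_normal_cdf_mono.
rewrite -ltNge => zw; rewrite ler_wpM2r ?subr_ge0 ?std_normal_cdf_le1//.
exact/std_normal_cdf_mono/ltW.
Qed.

Lemma stein_sol_ub z w : stein_sol z w <= (phi 1)^-1.
Proof. exact: le_trans (stein_sol_le_env _ _) (mills_env_ub _). Qed.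

Lemma norm_mul_stein_sol z w : `|w * stein_sol z w| <= 1.
Proof.
rewrite normrM (ger0_norm (stein_sol_ge0 _ _)).
by apply: le_trans (mills_env_norm w); rewrite ler_wpM2l ?stein_sol_le_env.
Qed.

Lemma is_derive_stein_solL z w : is_derive w 1
  (fun x => (1 - Phi z) * mills_l x) (w * ((1 - Phi z) * mills_l w) + 1 - Phi z).
Proof.
have d := is_derive_mills_l w.
have -> : (fun x => (1 - Phi z) * mills_l x) = (1 - Phi z) \*: mills_l by [].
apply: is_derive_eq; rewrite /GRing.scale/=; ring.
Qed.

Lemma is_derive_stein_solR z w : is_derive w 1
  (fun x => Phi z * mills_r x) (w * (Phi z * mills_r w) - Phi z).
Proof.
have d := is_derive_mills_r w.
have -> : (fun x => Phi z * mills_r x) = Phi z \*: mills_r by [].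
apply: is_derive_eq; rewrite /GRing.scale/=; ring.
Qed.

(** Off [z], with [f = stein_sol z], the derivative of [x f(x)] is [f(x) + x (x f(x) + e)] where [e]
    is [1 - Phi z] or [- Phi z]. Since [f] is at most [(phi 1)^-1] and both [x f(x)] and [e] are at
    most 1 in absolute value, it is bounded by [(phi 1)^-1 + 2 |x|]. *)
Lemma mul_stein_sol_lip z a b M : a <= b ->
  (forall x, a < x < b -> `|x| <= M) ->
  `|b * stein_sol z b - a * stein_sol z a| <= ((phi 1)^-1 + 2 * M) * (b - a).
Proof.
move=> ab aM; set C := (phi 1)^-1.
pose g x := x * stein_sol z x.
pose g1 x := x * ((1 - Phi z) * mills_l x).
pose g2 x := x * (Phi z * mills_r x).
pose dg1 x := (1 - Phi z) * mills_l x + x * (x * ((1 - Phi z) * mills_l x) + 1 - Phi z).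
pose dg2 x := Phi z * mills_r x + x * (x * (Phi z * mills_r x) - Phi z).
have D1 x : is_derive x 1 g1 (dg1 x).
  have d := is_derive_stein_solL z x.
  have -> : g1 = id * (fun x => (1 - Phi z) * mills_l x) by [].
  apply: is_derive_eq; rewrite /dg1 /GRing.scale/=; ring.
have D2 x : is_derive x 1 g2 (dg2 x).
  have d := is_derive_stein_solR z x.
  have -> : g2 = id * (fun x => Phi z * mills_r x) by [].
  apply: is_derive_eq; rewrite /dg2 /GRing.scale/=; ring.
have E1 x : x <= z -> g x = g1 x by move=> xz; rewrite /g stein_solL.
have E2 x : z <= x -> g x = g2 x by move=> xz; rewrite /g stein_solR.
have P0 := std_normal_cdf_ge0 z; have P1 := std_normal_cdf_le1 z.
have bnd x u e : `|x| <= M -> 0 <= u <= C -> `|x * u| <= 1 -> -1 <= e <= 1 ->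
    `|u + x * (x * u + e)| <= C + 2 * M.
  move=> xM /andP[u0 uC] xu /andP[e0 e1].
  apply: le_trans (ler_normD _ _) _; rewrite (ger0_norm u0) lerD// normrM mulrC.
  apply: ler_pM => //; apply: le_trans (ler_normD _ _) _.
  apply: (@le_trans _ _ (1 + 1)); last by lra.
  by rewrite lerD// ler_norml e0.
have B1 x : a < x < b -> x < z -> `|dg1 x| <= C + 2 * M.
  move=> /aM xM /ltW xz; rewrite /dg1 -stein_solL// -addrA.
  apply: bnd => //; first by rewrite stein_sol_ge0 stein_sol_ub.
    exact: norm_mul_stein_sol.
  by lra.
have B2 x : a < x < b -> z < x -> `|dg2 x| <= C + 2 * M.
  move=> /aM xM /ltW xz; rewrite /dg2 -stein_solR//.
  apply: bnd => //; first by rewrite stein_sol_ge0 stein_sol_ub.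
    exact: norm_mul_stein_sol.
  by lra.
rewrite -[X in X - _]/(g b) -[X in _ - X]/(g a) ler_norml -mulNr; apply/andP; split.
  apply: (piecewise_mvt_ge D1 D2 E1 E2 ab) => x xab xz.
    by have := B1 _ xab xz; rewrite ler_norml => /andP[].
  by have := B2 _ xab xz; rewrite ler_norml => /andP[].
apply: (piecewise_mvt_le D1 D2 E1 E2 ab) => x xab xz.
  by have := B1 _ xab xz; rewrite ler_norml => /andP[].
by have := B2 _ xab xz; rewrite ler_norml => /andP[].
Qed.

(** A Lipschitz constant for [x * stein_sol z x] at distance at most [d] from [w], uniform in
    [z]. *)
Definition stein_err w d := (phi 1)^-1 + 2 * (`|w| + d).

Lemma mul_stein_sol_near z a b w x : a <= w <= b -> a <= x <= b ->
  `|x * stein_sol z x - w * stein_sol z w| <= stein_err w (b - a) * (b - a).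
Proof.
move=> /andP[aw wb] /andP[ax xb].
have C0 : 0 <= (phi 1)^-1 by rewrite invr_ge0 ltW// normal_pdf01_gt0.
have E0 : 0 <= stein_err w (b - a).
  by rewrite addr_ge0// mulr_ge0// addr_ge0// subr_ge0 (le_trans aw).
have yM y : a <= y <= b -> `|y| <= `|w| + (b - a).
  move=> /andP[ay yb]; rewrite -[y](subrK w) addrC.
  by apply: le_trans (ler_normD _ _) _; rewrite lerD2l ler_norml; lra.
have [wx|/ltW xw] := leP w x.
  apply: (@le_trans _ _ (stein_err w (b - a) * (x - w))).
    apply: mul_stein_sol_lip => // y /andP[wy yx]; apply: yM; lra.
  by rewrite ler_wpM2l//; lra.
rewrite distrC; apply: (@le_trans _ _ (stein_err w (b - a) * (w - x))).
  apply: mul_stein_sol_lip => // y /andP[wy yx]; apply: yM; lra.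
by rewrite ler_wpM2l//; lra.
Qed.

(** By Stein's equation the derivative at [x] is [x f(x) + 1_(x <= z) - Phi z]. On the interval
    [x f(x)] stays close to [w f(w)], and the indicator, being nonincreasing, lies between its
    values at [b] and at [a]. *)
Lemma stein_sol_incr z a b w : a <= w <= b ->
  (w * stein_sol z w - stein_err w (b - a) * (b - a) + (b <= z)%R%:R - Phi z) * (b - a)
    <= stein_sol z b - stein_sol z a <=
  (w * stein_sol z w + stein_err w (b - a) * (b - a) + (a <= z)%R%:R - Phi z) * (b - a).
Proof.
move=> wab; have ab : a <= b by move: wab => /andP[]; exact: le_trans.
have near x : a < x < b -> `|x * stein_sol z x - w * stein_sol z w|
    <= stein_err w (b - a) * (b - a).
  by move=> /andP[ax xb]; apply: mul_stein_sol_near => //; rewrite !ltW.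
apply/andP; split.
  apply: (piecewise_mvt_ge (is_derive_stein_solL z) (is_derive_stein_solR z)
    (@stein_solL z) (@stein_solR z) ab) => x xab xz.
    rewrite -stein_solL ?(ltW xz)//.
    have := near _ xab; rewrite ler_norml => /andP[n1 n2].
    have e1 : (b <= z)%R%:R <= 1 :> R by rewrite lern1 leq_b1.
    move: (_%:R) e1 => e e1; lra.
  rewrite -stein_solR ?(ltW xz)//.
  have := near _ xab; rewrite ler_norml => /andP[n1 n2].
  have -> : (b <= z) = false.
    by apply/negbTE; rewrite -ltNge (lt_trans xz)//; case/andP: xab.
  rewrite addr0; lra.
apply: (piecewise_mvt_le (is_derive_stein_solL z) (is_derive_stein_solR z)
  (@stein_solL z) (@stein_solR z) ab) => x xab xz.
  rewrite -stein_solL ?(ltW xz)//.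
  have := near _ xab; rewrite ler_norml => /andP[n1 n2].
  have -> : a <= z by rewrite ltW// (lt_trans _ xz)//; case/andP: xab.
  rewrite -[true%:R]/(1 : R); lra.
rewrite -stein_solR ?(ltW xz)//.
have := near _ xab; rewrite ler_norml => /andP[n1 n2].
have e0 : 0 <= (a <= z)%R%:R :> R by rewrite ler0n.
move: (_%:R) e0 => e e0; lra.
Qed.

End stein.

(** * Sums of independent Bernoulli variables *)

Section bernoulli_sums.
Variable R : realType.
Implicit Types (s : seq R) (f g l : nat -> R) (p : R).

(** The expectation of [f] at the sum of independent Bernoulli variables with parameters in [s],
    computed by conditioning on the head; this encoding needs no probability space and suits
    induction. *)
Fixpoint ber_exp s f : R :=
  if s is p :: s' then (1 - p) * ber_exp s' f + p * ber_exp s' (f \o S)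
  else f 0%N.

Definition ber_mean s := \sum_(p <- s) p.

Definition ber_var s := \sum_(p <- s) p * (1 - p).

(** The probability generating function of the sum. *)
Definition ber_poly s : {poly R} := \prod_(p <- s) ((1 - p)%:P + p *: 'X).

Definition unit_itv s := all (fun p => 0 <= p <= 1) s.

Lemma eq_ber_exp s f g : f =1 g -> ber_exp s f = ber_exp s g.
Proof.
elim: s f g => [|p s IH] f g fg //=.
by rewrite (IH _ _ fg) (IH (f \o S) (g \o S))// => x /=.
Qed.

Lemma ber_expD s f g : ber_exp s (fun x => f x + g x) = ber_exp s f + ber_exp s g.
Proof.
elim: s f g => [|p s IH] f g //=.
rewrite IH (IH (f \o S) (g \o S)); ring.
Qed.

Lemma ber_expZ s (a : R) f : ber_exp s (fun x => a * f x) = a * ber_exp s f.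
Proof.
elim: s f => [|p s IH] f //=.
rewrite IH (IH (f \o S)); ring.
Qed.

Lemma ber_expB s f g : ber_exp s (fun x => f x - g x) = ber_exp s f - ber_exp s g.
Proof.
elim: s f g => [|p s IH] f g //=.
rewrite IH (IH (f \o S) (g \o S)); ring.
Qed.

Lemma ber_exp_cst s (a : R) : ber_exp s (fun=> a) = a.
Proof.
elim: s => [|p s IH] //=.
have e : (fun=> a) \o succn =1 fun=> a by [].
rewrite (eq_ber_exp s e) IH; ring.
Qed.

Lemma le_ber_exp s f g : unit_itv s -> (forall x, f x <= g x) ->
  ber_exp s f <= ber_exp s g.
Proof.
elim: s f g => [|p s IH] f g //= /andP[/andP[p0 p1] us] fg.
by rewrite lerD// ler_wpM2l ?subr_ge0// IH// => x; exact: fg.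
Qed.

(** Induction on [s]. Centring the head variable contributes [p * (1 - p)] times the mean increment
    of [f] over the sum of the tail. The total sum exceeds the tail sum by 0 or 1, so both
    hypotheses on [l] are used to see that this increment dominates the mean of [l] at the total
    sum. *)
Lemma ber_stein s f l : unit_itv s ->
  (forall x, l x <= f x.+1 - f x) -> (forall x, l x.+1 <= f x.+1 - f x) ->
  ber_var s * ber_exp s l <= ber_exp s (fun x => (x%:R - ber_mean s) * f x).
Proof.
rewrite /ber_mean /ber_var.
elim: s f l => [|p s IH] f l; first by rewrite !big_nil/= subrr !mul0r.
rewrite /= !big_cons => /andP[/andP[p0 p1] us] l1 l2.
set m := \sum_(q <- s) q; set v := \sum_(q <- s) q * (1 - q).
have q0 : 0 <= 1 - p by rewrite subr_ge0.
have H1 := IH f l us l1 l2.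
have H2 := IH (f \o S) (l \o S) us (fun x => l1 x.+1) (fun x => l2 x.+1).
rewrite -/m -/v in H1 H2.
have H3 : ber_exp s l <= ber_exp s (f \o S) - ber_exp s f.
  by rewrite -ber_expB; exact: le_ber_exp.
have H4 : ber_exp s (l \o S) <= ber_exp s (f \o S) - ber_exp s f.
  by rewrite -ber_expB; exact: le_ber_exp.
have -> : ber_exp s (fun x => (x%:R - (p + m)) * f x) =
    ber_exp s (fun x => (x%:R - m) * f x) - p * ber_exp s f.
  rewrite -mulNr -ber_expZ -ber_expD; apply: eq_ber_exp => x; ring.
have -> : ber_exp s ((fun x => (x%:R - (p + m)) * f x) \o S) =
    ber_exp s (fun x => (x%:R - m) * (f \o S) x) + (1 - p) * ber_exp s (f \o S).
  rewrite -ber_expZ -ber_expD; apply: eq_ber_exp => x /=.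
  rewrite -natr1; ring.
have H5 : (1 - p) * ber_exp s l + p * ber_exp s (l \o S) <=
    ber_exp s (f \o S) - ber_exp s f.
  have : (1 - p) * ber_exp s l + p * ber_exp s (l \o S) <=
     (1 - p) * (ber_exp s (f \o S) - ber_exp s f) +
     p * (ber_exp s (f \o S) - ber_exp s f).
    by rewrite lerD// ler_wpM2l.
  by move/le_trans; apply; rewrite -mulrDl subrK mul1r.
have := ler_wpM2l (mulr_ge0 p0 q0) H5.
have := ler_wpM2l q0 H1; have := ler_wpM2l p0 H2.
set A := ber_exp s (fun x => _); set B := ber_exp s (fun x => _ * (f \o S) x).
move: (ber_exp s l) (ber_exp s (l \o S)) (ber_exp s f) (ber_exp s (f \o S)) => a b c e.
lra.
Qed.

(** A constant [f] has zero increments; the values 1 and -1 turn the inequality of [ber_stein] into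
    an equality. *)
Lemma ber_exp_mean s : unit_itv s -> ber_exp s (fun x => x%:R) = ber_mean s.
Proof.
move=> us; have h (a : R) : 0 <= ber_exp s (fun x => (x%:R - ber_mean s) * a).
  have := @ber_stein s (fun=> a) (fun=> 0) us.
  by rewrite subrr ber_exp_cst mulr0; apply.
have := h 1; have := h (-1).
have -> : ber_exp s (fun x => (x%:R - ber_mean s) * -1) =
    ber_mean s - ber_exp s (fun x => x%:R).
  rewrite -[X in X - _](ber_exp_cst s) -ber_expB.
  by apply: eq_ber_exp => x; ring.
have -> : ber_exp s (fun x => (x%:R - ber_mean s) * 1) =
    ber_exp s (fun x => x%:R) - ber_mean s.
  rewrite -[X in _ - X](ber_exp_cst s) -ber_expB.
  by apply: eq_ber_exp => x; ring.
rewrite !subr_ge0 => *; apply/eqP; rewrite eq_le; exact/andP.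
Qed.

(** An affine [f] of slope [a] has increments exactly [a]; the slopes 1 and -1 again give both
    inequalities. *)
Lemma ber_exp_var s : unit_itv s ->
  ber_exp s (fun x => (x%:R - ber_mean s) ^+ 2) = ber_var s.
Proof.
move=> us; have h (a : R) : a * ber_var s <=
    a * ber_exp s (fun x => (x%:R - ber_mean s) ^+ 2).
  have e x : a = a * (x.+1%:R - ber_mean s) - a * (x%:R - ber_mean s).
    by rewrite -natr1; ring.
  have := @ber_stein s (fun x => a * (x%:R - ber_mean s)) (fun=> a) us.
  rewrite ber_exp_cst mulrC -ber_expZ => H; apply: (le_trans (H _ _)).
  - by move=> x; rewrite -e.
  - by move=> x; rewrite -e.
  - rewrite le_eqVlt; apply/orP; left; apply/eqP.
    by apply: eq_ber_exp => x; ring.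
have := h 1; have := h (-1); lra.
Qed.

(** The coefficients of the generating function are the point masses. The cutoff [N] is free because
    the two branches of the induction use [N.+1] and [N]. *)
Lemma ber_expE s N f : (size s < N)%N ->
  ber_exp s f = \sum_(x < N) (ber_poly s)`_x * f x.
Proof.
elim: s N f => [|p s IH] [//|N] f.
  move=> _; rewrite /ber_poly big_nil big_ord_recl/= big1 ?addr0 ?coef1 ?mul1r//.
  by move=> i _; rewrite coef1/= mul0r.
rewrite ltnS => sN; rewrite /= (IH N.+1); last exact: ltnW.
rewrite (IH N)// /ber_poly big_cons -/(ber_poly s).
under [RHS]eq_bigr do rewrite mulrDl coefD -scalerAl coefZ coefCM coefXM !mulrDl.
rewrite big_split/= mulr_sumr; congr (_ + _).
  by apply: eq_bigr => i _; ring.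
rewrite big_ord_recl/= mulr0 mul0r add0r mulr_sumr.
by apply: eq_bigr => i _; rewrite /= mulrA.
Qed.

End bernoulli_sums.

(** * The Bernoulli parameters of the Ewens law and bounds on the variance *)

Section ewens.
Variable R : realType.
Implicit Types (t : R) (n : nat).

Definition ewens_probs t n : seq R := [seq t / (t + i%:R) | i <- iota 0 n].

Lemma ewens_unit t n : 0 < t -> unit_itv (ewens_probs t n).
Proof.
move=> t0; apply/allP => p /mapP[i _ ->].
have ti : 0 < t + i%:R by rewrite ltr_pwDl.
by rewrite divr_ge0 ?(ltW t0) ?(ltW ti)//= ler_pdivrMr// mul1r lerDl.
Qed.

Lemma size_ewens_probs t n : size (ewens_probs t n) = n.
Proof. by rewrite size_map size_iota. Qed.

Lemma ewens_varE t n : 0 < t ->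
  ber_var (ewens_probs t n) = \sum_(0 <= i < n) (t * i%:R / (t + i%:R) ^+ 2).
Proof.
move=> t0; rewrite /ber_var /ewens_probs big_map /index_iota subn0.
apply: eq_bigr => i _.
have ti : t + i%:R != 0 by rewrite gt_eqF// ltr_pwDl.
by field.
Qed.

Lemma ewens_var_le_ln t n : 0 < t ->
  ber_var (ewens_probs t n) <= t * ln (1 + n%:R / t).
Proof.
move=> t0; rewrite ewens_varE//; case: n => [|n].
  by rewrite big_nil mul0r addr0 ln1 mulr0.
(* The term at 0 vanishes, so [n.+1] terms are bounded by the logarithm at [n]: the term at [i] is
   at most [t / (t + i)], hence at most [t] times the increment of [ln (1 + x / t)] from [i - 1] to
   [i]. *)
apply: (@le_trans _ _ (t * ln (1 + n%:R / t))); last first.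
  rewrite ler_wpM2l ?(ltW t0)// ler_ln ?posrE ?ltr_pwDl ?divr_ge0 ?(ltW t0)//.
  by rewrite lerD2l ler_pM2r ?invr_gt0// ler_nat.
elim: n => [|n IH].
  by rewrite big_nat1 mulr0 !mul0r addr0 ln1 mulr0.
rewrite big_nat_recr//=.
apply: le_trans (lerD IH (lexx _)) _.
rewrite -natr1; set x := n%:R.
have x0 : 0 <= x by rewrite /x.
clearbody x.
have tx : 0 < t + x by rewrite ltr_pwDl.
have tx1 : 0 < t + (x + 1) by rewrite addrA addr_gt0.
rewrite -lerBrDl -mulrBr -mulrA ler_pM2l//.
have -> : ln (1 + (x + 1) / t) - ln (1 + x / t) = - ln (1 - 1 / (t + (x + 1))).
  rewrite -[RHS]lnV ?posrE; last first.
    by rewrite subr_gt0 div1r invf_lt1// addrA ltrDr.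
  rewrite -ln_div ?posrE ?ltr_pwDl ?divr_ge0 ?addr_ge0 ?(ltW t0)//; congr ln.
  by field; rewrite addrA addrK !gt_eqF// -addrA.
apply: (@le_trans _ _ (1 / (t + (x + 1)))).
  rewrite ler_pdivlMr// mulrAC ler_pdivrMr ?exprn_gt0// mul1r expr2.
  by rewrite ler_wpM2r ?(ltW tx1)// lerDr ltW.
rewrite -lerN2 opprK; apply: le_trans (le_ln1Dx _) _ => //.
by rewrite ltrN2 div1r invf_lt1// addrA ltrDr.
Qed.

(** Each term splits as [t / (t + i) - t ^+ 2 / (t + i) ^+ 2]. The first part dominates the
    increment of [t * ln (1 + x / t)] from [i] to [i + 1]; the second parts add up to at most
    [t + 1]. *)
Lemma ewens_var_ge_ln t n : 0 < t ->
  t * ln (1 + n%:R / t) - t - 1 <= ber_var (ewens_probs t n).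
Proof.
move=> t0; rewrite ewens_varE//.
(* [t^2 / (t + i)^2 <= (t^2 + t) / ((t + i) (t + i + 1))], which telescopes. *)
suff : t * ln (1 + n%:R / t) - t - 1 + (t ^+ 2 + t) / (t + n%:R) <=
    \sum_(0 <= i < n) t * i%:R / (t + i%:R) ^+ 2.
  by apply: le_trans; rewrite lerDl divr_ge0// addr_ge0 ?sqr_ge0 ?(ltW t0).
elim: n => [|n IH].
  rewrite big_nil mul0r !addr0 ln1 mulr0 sub0r.
  by rewrite (_ : (t ^+ 2 + t) / t = t + 1); [lra|field; rewrite gt_eqF].
rewrite big_nat_recr//=.
apply: le_trans (lerD IH (lexx _)).
set x := n%:R.
have x0 : 0 <= x by rewrite /x.
have xx : n.+1%:R = x + 1 by rewrite /x -natr1.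
clearbody x.
have tx : 0 < t + x by rewrite ltr_pwDl.
rewrite xx.
have lnle : ln (1 + (x + 1) / t) - ln (1 + x / t) <= 1 / (t + x).
  rewrite -ln_div ?posrE ?ltr_pwDl ?divr_ge0 ?addr_ge0 ?(ltW t0)//.
  have -> : (1 + (x + 1) / t) / (1 + x / t) = 1 + 1 / (t + x).
    by field; rewrite !gt_eqF.
  by apply: le_ln1Dx; apply: (@lt_trans _ _ 0) => //; rewrite divr_gt0.
have sq : (t ^+ 2 + t) / (t + (x + 1)) - (t ^+ 2 + t) / (t + x) <=
    - (t ^+ 2 / (t + x) ^+ 2).
  rewrite lerNr opprB.
  have -> : (t ^+ 2 + t) / (t + x) - (t ^+ 2 + t) / (t + (x + 1)) =
      (t ^+ 2 + t) / ((t + x) * (t + x + 1)).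
    by field; rewrite !gt_eqF// addr_gt0.
  rewrite ler_pdivrMr ?exprn_gt0// mulrAC ler_pdivlMr ?mulr_gt0 ?(addr_gt0 tx)//.
  by have := mulr_ge0 (mulr_ge0 (ltW t0) x0) (ltW tx); nra.
have -> : t * x / (t + x) ^+ 2 = t * (1 / (t + x)) - t ^+ 2 / (t + x) ^+ 2.
  by field; rewrite gt_eqF.
have := ler_wpM2l (ltW t0) lnle; lra.
Qed.

(** All denominators are replaced by the largest one, and [n (n - 1) / 2 >= n ^+ 2 / 4] for
    [n >= 2]. The bound has the right order when [n] is at most of order [t]. *)
Lemma ewens_var_ge t n : 0 < t -> (1 < n)%N ->
  t * n%:R ^+ 2 / (4 * (t + n%:R) ^+ 2) <= ber_var (ewens_probs t n).
Proof.
move=> t0 n1; rewrite ewens_varE//.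
have n0 : 0 < n%:R :> R by rewrite ltr0n; case: n n1.
have s : \sum_(0 <= i < n) i%:R = n%:R * (n%:R - 1) / 2 :> R.
  elim: (n) => [|k IH]; first by rewrite big_nil !mul0r.
  by rewrite big_nat_recr//= IH -natr1; field.
apply: (@le_trans _ _ (\sum_(0 <= i < n) t * i%:R / (t + n%:R) ^+ 2)).
  rewrite -mulr_suml -mulr_sumr s.
  rewrite invfM !mulrA ler_wpM2r ?invr_ge0 ?sqr_ge0//.
  have n2 : 0 <= n%:R - 2 :> R by rewrite subr_ge0 ler_nat.
  have := mulr_ge0 (mulr_ge0 (ltW t0) (ltW n0)) n2.
  lra.
rewrite [leLHS]big_nat [leRHS]big_nat; apply: ler_sum => i /andP[_ ni].
have ti : 0 < t + i%:R by rewrite ltr_pwDl.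
rewrite ler_wpM2l ?mulr_ge0 ?(ltW t0)//.
have tn : 0 < t + n%:R by rewrite addr_gt0.
rewrite lef_pV2 ?posrE ?exprn_gt0//.
by rewrite ler_pXn2r ?nnegrE ?(ltW ti) ?addr_ge0 ?(ltW t0)// lerD2l ler_nat ltnW.
Qed.

Lemma ewens_var_le t n : 0 < t -> ber_var (ewens_probs t n) <= n%:R ^+ 2 / t.
Proof.
move=> t0; rewrite ewens_varE//.
apply: (@le_trans _ _ (\sum_(0 <= i < n) (n%:R / t))); last first.
  by rewrite big_const_nat subn0 iter_addr_0 -[_ *+ n]mulr_natl mulrA -expr2.
rewrite [leLHS]big_nat [leRHS]big_nat; apply: ler_sum => i /andP[_ ni].
rewrite ler_pdivlMr// mulrAC ler_pdivrMr ?exprn_gt0 ?ltr_pwDl//.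
rewrite (_ : t * i%:R * t = i%:R * t ^+ 2); last by ring.
apply: ler_pM; rewrite ?sqr_ge0// ?ler_nat 1?ltnW//.
by rewrite ler_pXn2r ?nnegrE ?addr_ge0 ?(ltW t0)// lerDl.
Qed.

End ewens.

(** * Integrals against a discrete law, and the law of [K] as that of a Bernoulli sum *)

Lemma integral_atoms (R : realType) (d : measure_display) (T : measurableType d)
    (P : probability T R) (K : {RV P >-> R})
    (s : seq nat) (a : nat -> R) (h : R -> R) :
  uniq s -> (forall x, x \in s -> P [set w | K w = x%:R] = (a x)%:E) ->
  \sum_(x <- s) a x = 1 -> measurable_fun [set: R] h ->
  (\int[P]_w (h (K w))%:E = (\sum_(x <- s) h x%:R * a x)%:E)%E.
Proof.
move=> us Pa a1 mh.
pose F (x : nat) := [set w | K w = x%:R].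
have mF x : measurable (F x).
  by rewrite -[F x]setTI; exact: (measurable_funPT K measurableT _ (measurable_set1 _)).
have tF : trivIset [set` s] F.
  by move=> i j _ _ [w [wi wj]]; apply/eqP; rewrite -(eqr_nat R) -wi -wj.
pose D := \big[setU/set0]_(x <- s) F x.
have mD : measurable D by apply: bigsetU_measurable.
have sumF (g : R -> R) : measurable_fun [set: R] g ->
    (\int[P]_(w in D) (g (K w))%:E = (\sum_(x <- s) g x%:R * a x)%:E)%E.
  move=> mg; rewrite (integral_bigsetU_EFin P mF us tF (f := g \o K)); last first.
    apply/measurable_EFinP; apply: (measurable_funS (E := setT)) => //.
    exact: measurableT_comp.
  rewrite -sumEFin !big_seq; apply: eq_bigr => x xs.
  rewrite EFinM -Pa// -(integral_cst P (mF x)).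
  by apply: eq_integral => w; rewrite inE/= => ->.
(* The constant function 1 shows that the atoms in [s] carry all the mass; the complement of [D] is
   null, and the integral reduces to [D]. *)
have PD : P D = 1%E.
  rewrite -[LHS]mul1e -(integral_cst P mD).
  rewrite [LHS](sumF (cst 1) (measurable_cst _)).
  congr EFin; rewrite -[RHS]a1; apply: eq_bigr => x _; exact: mul1r.
rewrite -sumF// [RHS]integral_mkcond.
apply: ae_eq_integral => //.
- by apply/measurable_EFinP; exact: measurableT_comp.
- apply/(measurable_restrictT _ _).1 => //.
  apply/measurable_EFinP; apply: (measurable_funS (E := setT)) => //.
  exact: measurableT_comp.
- exists (~` D); split; first exact: measurableC.
    have PC : P (~` D) = 0%E by rewrite probability_setC// PD subee.
    exact: PC.
  move=> w /= H Dw; apply: H => _; rewrite /patch mem_set//.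
Qed.

Section ewens_law.
Variables (R : realType) (d : measure_display) (T : measurableType d).
Variables (P : probability T R) (n : nat) (t : R) (K : {RV P >-> R}).
Hypotheses (n0 : (0 < n)%N) (t0 : 0 < t) (K_law : ewens_K_law n t K).

Let s := ewens_probs t n.

(** The factor of index [i] in the generating function is [(t X + i) / (t + i)]. *)
Lemma ewens_ber_poly : ber_poly s =
  (rising_poly R n).[t]^-1 *: (rising_poly R n \Po (t *: 'X)).
Proof.
rewrite /rising_poly rmorph_prod horner_prod -prodfV -scaler_prod.
rewrite /ber_poly /s /ewens_probs big_map.
rewrite -[in LHS](subn0 n) -/(index_iota 0 n) big_mkord.
apply: eq_bigr => i _.
have ti : t + i%:R != 0 by rewrite gt_eqF// ltr_pwDl.
rewrite /= comp_polyD comp_polyX comp_polyC !hornerE scalerDr scalerA addrC.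
congr (_ + _); first by rewrite mulrC.
rewrite -mul_polyC -polyCM; congr (_%:P); by field.
Qed.

Lemma ewens_coef x : (ber_poly s)`_x =
  (rising_poly R n)`_x * t ^+ x / (rising_poly R n).[t].
Proof.
rewrite ewens_ber_poly coefZ mulrC; congr (_ * _).
rewrite comp_polyE coef_sum.
under eq_bigr do rewrite coefZ exprZn coefZ coefXn.
have [xs|sx] := ltnP x (size (rising_poly R n)).
  rewrite (bigD1 (Ordinal xs))//= eqxx mulr1 big1 ?addr0// => i ix.
  by rewrite eq_sym -val_eqE/= in ix *; rewrite (negbTE ix) !mulr0.
rewrite nth_default// mul0r big1// => i _.
by rewrite gtn_eqF ?mulr0// (leq_trans (ltn_ord i)).
Qed.

Lemma ewens_integral (h : R -> R) : measurable_fun [set: R] h ->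
  (\int[P]_w (h (K w))%:E = (ber_exp s (fun x => h x%:R))%:E)%E.
Proof.
(* The hypothesis on the law starts at [x = 1]; there is no mass at 0 because, for [0 < n], the
   rising factorial has the factor [X]. *)
have s0 : (ber_poly s)`_0 = 0.
  rewrite ewens_coef (_ : (rising_poly R n)`_0 = 0) ?mul0r//.
  rewrite /rising_poly -horner_coef0 horner_prod; case: (n) n0 => // m _.
  by rewrite big_ord_recl/= hornerD hornerX hornerC addr0 mul0r.
have sE f : ber_exp s f = \sum_(x <- index_iota 1 n.+1) f x * (ber_poly s)`_x.
  rewrite (@ber_expE _ s n.+1) ?size_ewens_probs// big_ord_recl s0 mul0r add0r.
  rewrite big_add1 /= big_mkord; apply: eq_bigr => i _; exact: mulrC.
move=> mh;
rewrite (integral_atoms (s := index_iota 1 n.+1)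
  (a := fun x => (ber_poly s)`_x))//.
- by rewrite sE.
- exact: iota_uniq.
- by move=> x; rewrite mem_index_iota ltnS => /K_law ->; rewrite ewens_coef.
- rewrite -(ber_exp_cst s 1) sE; apply: eq_bigr => x _; exact/esym/mul1r.
Qed.

Let us := ewens_unit n t0.

Lemma ewens_mean : mean K = ber_mean s.
Proof.
rewrite /mean expectation_def.
rewrite (ewens_integral (h := idfun)) ?ber_exp_mean//; exact: measurable_id.
Qed.

Lemma ewens_stddev : stddev K = Num.sqrt (ber_var s).
Proof.
rewrite /stddev /variance covariance.unlock -/(mean K) ewens_mean.
rewrite expectation.unlock.
pose h (x : R) := (x - ber_mean s) ^+ 2.
have mh : measurable_fun [set: R] h by apply: measurable_funX; exact: measurable_funB.
by rewrite [X in fine X](ewens_integral mh) -ber_exp_var.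
Qed.

Lemma ewens_cdf x : standardized_cdf K x =
  ber_exp s (fun k => (((k%:R - ber_mean s) / Num.sqrt (ber_var s)) <= x)%R%:R).
Proof.
pose h (y : R) : R := \1_[set z | (z - ber_mean s) / Num.sqrt (ber_var s) <= x] y.
have mA : measurable [set z : R | (z - ber_mean s) / Num.sqrt (ber_var s) <= x].
  rewrite (_ : mkset _ =
      (fun z => (z - ber_mean s) / Num.sqrt (ber_var s)) @^-1` `]-oo, x]).
    rewrite -[_ @^-1` _]setTI.
    have : measurable_fun [set: R] (fun z : R =>
        (z - ber_mean s) / Num.sqrt (ber_var s)).
      by apply: measurable_funM => //; exact: measurable_funB.
    by apply => //; exact: measurable_itv.
  by apply/seteqP; split => z /=; rewrite in_itv.
have mh : measurable_fun [set: R] h by exact: measurable_indic.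
transitivity (fine (\int[P]_w (h (K w))%:E)%E); last first.
  rewrite (ewens_integral mh)/=; apply: eq_ber_exp => k.
  rewrite /h indicE; congr (_%:R); congr nat_of_bool.
  by apply/idP/idP; rewrite inE.
rewrite /standardized_cdf /cdf /distribution /pushforward.
rewrite -[X in P X]setIT -integral_indic//; last first.
  rewrite -[X in measurable X]setTI; exact: measurable_standardize.
congr fine; apply: eq_integral => w _; rewrite /h !indicE; congr ((_%:R)%:E).
congr nat_of_bool; apply/idP/idP; rewrite !inE/= in_itv/= /standardize.
all: by rewrite ewens_mean ewens_stddev.
Qed.

End ewens_law.

(** * Upper and lower bounds of order [1 / sigma] for Bernoulli sums *)

Section berry_esseen.
Variables (R : realType) (s : seq R).
Hypotheses (us : unit_itv s) (v1 : 1 <= ber_var s).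

Local Notation phi := (@normal_pdf R 0 1).
Local Notation Phi := (@std_normal_cdf R).
Local Notation sigma := (Num.sqrt (ber_var s)).

Definition ber_std (k : nat) : R := (k%:R - ber_mean s) / sigma.

Definition ber_cdf (x : R) : R := ber_exp s (fun k => (ber_std k <= x)%R%:R).

Let sg1 : 1 <= sigma.
Proof. by rewrite -[leLHS]sqrtr1 ler_sqrt// (le_trans ler01). Qed.

Let sg0 : 0 < sigma. Proof. exact: lt_le_trans ltr01 sg1. Qed.

Let vE : ber_var s = sigma ^+ 2.
Proof. by rewrite sqr_sqrtr// (le_trans ler01). Qed.

(** The mesh of the lattice of standardized values. *)
Let d := sigma^-1.

Let vd : ber_var s * d = sigma.
Proof. by rewrite [X in X * _]vE expr2 mulfK// gt_eqF. Qed.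

Let d0 : 0 < d. Proof. by rewrite invr_gt0. Qed.

Let d1 : d <= 1. Proof. by rewrite invf_le1. Qed.

Lemma ber_stdS k : ber_std k.+1 = ber_std k + d.
Proof. by rewrite /ber_std -natr1 addrAC mulrDl mul1r. Qed.

(** From [2 a <= 1 + a ^+ 2] and the unit second moment of the standardized sum. *)
Lemma ber_exp_norm_std : ber_exp s (fun k => `|ber_std k|) <= 1.
Proof.
have H : ber_exp s (fun k => 2 * `|ber_std k|) <=
    ber_exp s (fun k => 1 + d ^+ 2 * (k%:R - ber_mean s) ^+ 2).
  apply: le_ber_exp => // k; rewrite -exprMn mulrC -/(ber_std k).
  rewrite -(real_normK (num_real (d * _))) [d * _]mulrC -/(ber_std k).
  move: `|_| => a; have := sqr_ge0 (a - 1); lra.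
move: H; rewrite ber_expD !ber_expZ ber_exp_cst ber_exp_var//.
rewrite vE -exprMn mulVf ?gt_eqF//.
rewrite expr1n; lra.
Qed.

Let C := (phi 1)^-1.

Let ber_exp_err : ber_exp s (fun k => stein_err (ber_std k) d) <= C + 4.
Proof.
rewrite (@eq_ber_exp _ _ _ (fun k => (C + 2 * d) + 2 * `|ber_std k|)); last first.
  by move=> k; rewrite /stein_err -/C; ring.
rewrite ber_expD ber_exp_cst ber_expZ; have := ber_exp_norm_std; have := d1; lra.
Qed.

(** [ber_stein] is applied to the Stein solution sampled on the lattice. The threshold [z - d] in
    [l] guarantees that, at either end of a step, the indicator is at most that of
    [ber_std k.+1 <= z], the one in the lower bound of [stein_sol_incr]. *)
Lemma ber_cdf_stein_ge z : ber_cdf (z - d) <= Phi z + (C + 4) * d.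
Proof.
pose f k := stein_sol z (ber_std k).
pose l k := (ber_std k * f k - stein_err (ber_std k) d * d +
  (ber_std k <= z - d)%R%:R - Phi z) * d.
have lf k w : w = k \/ w = k.+1 -> l w <= f k.+1 - f k.
  move=> wk.
  have wk' : ber_std k <= ber_std w <= ber_std k + d.
    by case: wk => ->; rewrite ?ber_stdS lexx ?lerDl (ltW d0).
  have /andP[+ _] := stein_sol_incr z wk'.
  rewrite (_ : ber_std k + d - ber_std k = d); last by rewrite addrC addKr.
  rewrite -ber_stdS; apply: le_trans.
  rewrite ler_pM2r// lerD2r lerD2l ler_nat ber_stdS.
  case: (leP (ber_std w) (z - d)) => // h; rewrite lt0b.
  by case/andP: wk' => wk1 wk2; rewrite -lerBrDr (le_trans wk1).
have := ber_stein us (fun k => lf k k (or_introl erefl))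
  (fun k => lf k k.+1 (or_intror erefl)).
have -> : ber_exp s (fun k => (k%:R - ber_mean s) * f k) =
    sigma * ber_exp s (fun k => ber_std k * f k).
  rewrite -ber_expZ; apply: eq_ber_exp => k.
  by rewrite mulrA /ber_std mulrCA divff ?mulr1// gt_eqF.
have -> : ber_exp s l = d * (ber_exp s (fun k => ber_std k * f k)
    - d * ber_exp s (fun k => stein_err (ber_std k) d) + ber_cdf (z - d) - Phi z).
  rewrite (@eq_ber_exp _ _ l (fun k => d * ((ber_std k * f k
    - d * stein_err (ber_std k) d) + ((ber_std k <= z - d)%R%:R - Phi z)))).
    by rewrite ber_expZ ber_expD !ber_expB ber_expZ ber_exp_cst addrA.
  by move=> k; rewrite /l; ring.
(* As [ber_var s * d = sigma], both sides carry the factor [sigma]; after division the means of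
   [ber_std k * f k] cancel. *)
rewrite mulrA vd ler_pM2l//.
have := ler_wpM2l (ltW d0) ber_exp_err; lra.
Qed.

(** The mirror argument: the opposite of the Stein solution, the upper bound of [stein_sol_incr],
    and the threshold moved to [z + d]. *)
Lemma ber_cdf_stein_le z : Phi z - (C + 4) * d <= ber_cdf (z + d).
Proof.
pose f k := - stein_sol z (ber_std k).
pose l k := (ber_std k * f k - stein_err (ber_std k) d * d -
  (ber_std k <= z + d)%R%:R + Phi z) * d.
have lf k w : w = k \/ w = k.+1 -> l w <= f k.+1 - f k.
  move=> wk.
  have wk' : ber_std k <= ber_std w <= ber_std k + d.
    by case: wk => ->; rewrite ?ber_stdS lexx ?lerDl (ltW d0).
  have /andP[_] := stein_sol_incr z wk'.
  rewrite (_ : ber_std k + d - ber_std k = d); last by rewrite addrC addKr.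
  rewrite -ber_stdS -lerN2 => H.
  rewrite /f opprK addrC -opprB; apply: le_trans H.
  rewrite -mulNr ler_pM2r// /l /f mulrN !opprB.
  have : (ber_std k <= z)%R%:R <= (ber_std w <= z + d)%R%:R :> R.
    rewrite ler_nat; case: (leP (ber_std k) z) => // h; rewrite lt0b.
    by case/andP: wk' => wk1 wk2; rewrite (le_trans wk2)// lerD2r.
  lra.
have := ber_stein us (fun k => lf k k (or_introl erefl))
  (fun k => lf k k.+1 (or_intror erefl)).
have -> : ber_exp s (fun k => (k%:R - ber_mean s) * f k) =
    sigma * ber_exp s (fun k => ber_std k * f k).
  rewrite -ber_expZ; apply: eq_ber_exp => k.
  by rewrite mulrA /ber_std mulrCA divff ?mulr1// gt_eqF.
have -> : ber_exp s l = d * (ber_exp s (fun k => ber_std k * f k)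
    - d * ber_exp s (fun k => stein_err (ber_std k) d) - ber_cdf (z + d) + Phi z).
  rewrite (@eq_ber_exp _ _ l (fun k => d * ((ber_std k * f k
    - d * stein_err (ber_std k) d) - (ber_std k <= z + d)%R%:R + Phi z))).
    by rewrite ber_expZ ber_expD !ber_expB ber_expZ ber_exp_cst.
  by move=> k; rewrite /l; ring.
rewrite mulrA vd ler_pM2l//.
have := ler_wpM2l (ltW d0) ber_exp_err; lra.
Qed.

(** Undoing the shift by [d] costs at most [d], since [Phi] is 1-Lipschitz; hence 5 in place of
    4. *)
Lemma dist_ber_cdf_le x : `|ber_cdf x - Phi x| <= (C + 5) * d.
Proof.
have := ber_cdf_stein_ge (x + d); have := ber_cdf_stein_le (x - d).
rewrite subrK addrK.
have dd := d0.
have : Phi x - Phi (x - d) <= x - (x - d) by apply: std_normal_cdf_lip; lra.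
have : Phi (x + d) - Phi x <= x + d - x by apply: std_normal_cdf_lip; lra.
rewrite ler_norml; lra.
Qed.

Lemma le_sup_dist_ber_cdf D : (forall x, `|ber_cdf x - Phi x| <= D) ->
  phi 1 / 4 * d <= D.
Proof.
move=> FD; set m := ber_mean s.
have m0 : 0 <= m.
  by rewrite /m /ber_mean big_seq sumr_ge0// => p /(allP us)/andP[].
(* The lattice step starting at the integer part of the mean lies within [[-1, 1]] after
   standardization, where the density is at least [phi 1]. *)
have /andP[km mk] := truncn_itv m0; set k := Num.trunc m in km mk *.
have Wk0 : -1 <= ber_std k <= 0.
  rewrite /ber_std ler_pdivrMr// mul0r ler_pdivlMr// -natr1 in mk *.
  by rewrite -/m; apply/andP; split; [have := sg1; lra|lra].
have Wk1 : ber_std k + d <= 1 by have := d1; lra.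
(* The midpoint of the step: [ber_cdf] is the same at [y] and at [ber_std k], while [Phi] grows by
   at least [phi 1 * d / 2], which is thus at most [2 D]. *)
pose y := ber_std k + d / 2.
have Fy : ber_cdf y = ber_cdf (ber_std k).
  apply: eq_ber_exp => j; congr (_%:R); congr nat_of_bool.
  have [jk|kj] := leqP j k.
    have jk' : ber_std j <= ber_std k.
      by rewrite ler_pM2r// lerD2r ler_nat.
    by rewrite jk'; apply: (le_trans jk'); rewrite lerDl divr_ge0 ?(ltW d0).
  have kj' : ber_std k + d <= ber_std j.
    by rewrite -ber_stdS ler_pM2r// lerD2r ler_nat.
  have dd := d0; rewrite !leNgt (lt_le_trans _ kj') ?(lt_le_trans _ kj')//.
    by rewrite ltrDl.
  by rewrite /y; lra.
have P : phi 1 * (y - ber_std k) <= Phi y - Phi (ber_std k).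
  apply: (mvt_ge (@is_derive_std_normal_cdf R)); first by rewrite /y; have := d0; lra.
  move=> x /andP[kx xy]; apply: normal_pdf01_ge; rewrite ler_norml.
  rewrite /y in xy; have := d0; lra.
have := FD y; have := FD (ber_std k); rewrite Fy !ler_norml.
move=> /andP[a1 a2] /andP[a3 a4].
rewrite /y in P a3 a4; lra.
Qed.

End berry_esseen.

(** * From bounds by the standard deviation to asymptotic orders *)

Lemma sup_norm_ewens_bounds (R : realType) (d : measure_display) (T : measurableType d)
    (P : probability T R) (n : nat) (t : R) (K : {RV P >-> R}) :
  (0 < n)%N -> 0 < t -> ewens_K_law n t K ->
  1 <= ber_var (ewens_probs t n) ->
  normal_pdf 0 1 1 / 4 * (Num.sqrt (ber_var (ewens_probs t n)))^-1
  <= sup_norm (fun x : R => standardized_cdf K x - std_normal_cdf x)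
  <= ((normal_pdf 0 1 1)^-1 + 5) * (Num.sqrt (ber_var (ewens_probs t n)))^-1.
Proof.
move=> n0 t0 K_law v1.
have us := ewens_unit n t0.
pose f x := `|standardized_cdf K x - std_normal_cdf x|.
have fE x : f x = `|ber_cdf (ewens_probs t n) x - std_normal_cdf x|.
  by rewrite /f (ewens_cdf n0 t0 K_law).
have ub x : f x <=
    ((normal_pdf 0 1 1)^-1 + 5) * (Num.sqrt (ber_var (ewens_probs t n)))^-1.
  by rewrite fE; exact: dist_ber_cdf_le.
have f0 : range f !=set0 by exists (f 0), 0.
apply/andP; split; last by apply: ge_sup => // _ [x _ <-]; exact: ub.
apply: le_sup_dist_ber_cdf => // x; rewrite -fE.
(* The supremum dominates the values only if the range is bounded above, which the pointwise upper
   bound [ub] provides. *)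
apply: ub_le_sup; last by exists x.
by eexists => _ [y _ <-]; exact: ub.
Qed.

(** Transfers the bounds from the variance [v] to a comparable explicit sequence [b]; its divergence
    ensures [1 <= v n] eventually. *)
Lemma asymp_inv_sqrt (R : realType) (a b v : nat -> R) (l u k1 k2 : R) :
  0 < l -> 0 < u -> 0 < k1 -> 0 < k2 ->
  (\forall n \near \oo, 1 <= v n ->
    l * (Num.sqrt (v n))^-1 <= a n <= u * (Num.sqrt (v n))^-1) ->
  b n @[n --> \oo] --> +oo ->
  (\forall n \near \oo, k1 * b n <= v n <= k2 * b n) ->
  asymp a (fun n => 1 / Num.sqrt (b n)).
Proof.
move=> l0 u0 k10 k20 av /cvgryPge boo bv.
exists (l / Num.sqrt k2), (u / Num.sqrt k1); split.
  by rewrite divr_gt0// sqrtr_gt0.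
near=> n.
have b1 : k1^-1 <= b n by near: n; exact: boo.
have b0 : 0 < b n by apply: lt_le_trans b1; rewrite invr_gt0.
have /andP[bv1 bv2] : k1 * b n <= v n <= k2 * b n by near: n.
have v1 : 1 <= v n by apply: le_trans bv1; rewrite -ler_pdivrMl// mulr1.
have v0 : 0 < v n by exact: lt_le_trans v1.
have /andP[la au] : l * (Num.sqrt (v n))^-1 <= a n <= u * (Num.sqrt (v n))^-1.
  by move: v1; near: n.
have sb : 0 < Num.sqrt (b n) by rewrite sqrtr_gt0.
have sv : 0 < Num.sqrt (v n) by rewrite sqrtr_gt0.
have {}la : l <= a n * Num.sqrt (v n) by rewrite -ler_pdivrMr.
have {}au : a n * Num.sqrt (v n) <= u by rewrite -ler_pdivlMr.
rewrite div1r invrK.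
have a0 : 0 <= a n by rewrite -(pmulr_lge0 _ sv) (le_trans _ la)// ltW.
apply/andP; split.
  rewrite ler_pdivrMr ?sqrtr_gt0//; apply: le_trans la _.
  rewrite -mulrA ler_wpM2l// -sqrtrM ?(ltW b0)// ler_sqrt.
    by rewrite mulrC.
  by rewrite mulr_ge0 ?ltW.
rewrite ler_pdivlMr ?sqrtr_gt0//; apply: le_trans au.
rewrite -mulrA ler_wpM2l// -sqrtrM ?(ltW b0)// ler_sqrt ?(ltW v0)//.
by rewrite mulrC.
Unshelve. all: by end_near. Qed.

(** * The order of the variance in the three regimes *)

Section regimes.
Variables (R : realType) (theta : nat -> R).
Hypothesis theta_gt0 : forall n : nat, (0 < n)%N -> 0 < theta n.

Local Notation v := (fun n => ber_var (ewens_probs (theta n) n)).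
Local Notation r := (fun n => n%:R / theta n).

(** Monotonicity keeps [theta n] above [theta 1 > 0], so [theta n * ln (r n)] diverges with
    [ln (r n)] and absorbs the error [theta n + 1] of the logarithmic lower bound. *)
Lemma caseA_var :
  (forall m n : nat, (0 < m)%N -> (m <= n)%N -> theta m <= theta n) ->
  caseA theta ->
  theta n * ln (n%:R / theta n) @[n --> \oo] --> +oo /\
  \forall n \near \oo, 2^-1 * (theta n * ln (n%:R / theta n)) <= v n <=
    2 * (theta n * ln (n%:R / theta n)).
Proof.
move=> theta_nd /cvgryPge roo.
have t1 : 0 < theta 1 by exact: theta_gt0.
have lnr (A : R) : \forall n \near \oo, A <= ln (r n).
  near=> n; rewrite -[A]expRK ler_ln ?posrE ?expR_gt0//; first by near: n; exact: roo.
  by apply: lt_le_trans (expR_gt0 A) _; near: n; exact: roo.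
split.
  apply/cvgryPge => A; near=> n.
  have t1n : theta 1 <= theta n by apply: theta_nd => //; near: n; exact: nbhs_infty_gt.
  have L : `|A| / theta 1 <= ln (r n) by near: n; exact: lnr.
  apply: le_trans (ler_norm _) _.
  rewrite -[leLHS](divfK (lt0r_neq0 t1)) mulrC.
  by apply: ler_pM => //; [exact: ltW|rewrite divr_ge0// ltW].
near=> n.
have n0 : (0 < n)%N by near: n; exact: nbhs_infty_gt.
have tn := theta_gt0 n0.
have t1n : theta 1 <= theta n by exact: theta_nd.
have r2 : 2 <= r n by near: n; exact: roo.
(* Chosen so that half of [theta n * ln (r n)] is at least [theta n + 1]. *)
have L : 2 * (1 + (theta 1)^-1) <= ln (r n) by near: n; exact: lnr.
apply/andP; split.
  apply: le_trans (ewens_var_ge_ln n tn).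
  have H1 : theta n * ln (r n) <= theta n * ln (1 + r n).
    by rewrite ler_pM2l// ler_ln ?posrE; lra.
  have H2 : 1 <= theta n * (theta 1)^-1 by rewrite ler_pdivlMr// mul1r.
  have H3 := ler_wpM2l (ltW tn) L.
  lra.
apply: le_trans (ewens_var_le_ln n tn) _.
(* The factor 2 comes from [1 + r <= r ^+ 2] for [r >= 2]. *)
rewrite mulrCA ler_pM2l// [2 * _]mulr_natl -lnXn; last by lra.
rewrite ler_ln ?posrE; [|lra|by rewrite exprn_gt0//; lra].
nra.
Unshelve. all: by end_near. Qed.

(** Eventually [r n] lies between [c / 2] and [c + 1]. So [theta n] grows at least like
    [n / (c + 1)], and the algebraic bounds, written as [theta n] times a function of [r n], have
    the stated constants. *)
Lemma caseB_var (c : R) : 0 < c -> n%:R / theta n @[n --> \oo] --> c ->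
  theta n @[n --> \oo] --> +oo /\
  \forall n \near \oo, (c / 2) ^+ 2 / (4 * (2 + c) ^+ 2) * theta n <= v n <=
    (c + 1) ^+ 2 * theta n.
Proof.
move=> c0 rc.
have rub : \forall n \near \oo, r n <= c + 1.
  by near=> n; apply/ltW; near: n; apply: (cvgr_lt c) => //; rewrite ltrDl.
have rlb : \forall n \near \oo, c / 2 <= r n.
  by near=> n; apply/ltW; near: n; apply: (cvgr_gt c) => //; lra.
split.
  apply/cvgryPge => A; near=> n.
  have n0 : (0 < n)%N by near: n; exact: nbhs_infty_gt.
  have tn := theta_gt0 n0.
  have : r n <= c + 1 by near: n.
  have nA : A * (c + 1) <= n%:R by near: n; exact: nbhs_infty_ger.
  rewrite ler_pdivrMr// => H.
  have c1 : 0 < c + 1 by lra.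
  by rewrite -(ler_pM2r c1) (le_trans nA)// mulrC.
near=> n.
have n1 : (1 < n)%N by near: n; exact: nbhs_infty_gt.
have tn := theta_gt0 (ltnW n1).
have r1 : c / 2 <= r n by near: n.
have r2 : r n <= c + 1 by near: n.
have r0 : 0 < r n by lra.
have nE : n%:R = r n * theta n by rewrite divfK// gt_eqF.
apply/andP; split.
  apply: le_trans (ewens_var_ge tn n1).
  have -> : theta n * n%:R ^+ 2 / (4 * (theta n + n%:R) ^+ 2) =
      r n ^+ 2 / (4 * (1 + r n) ^+ 2) * theta n.
    rewrite nE; move: (r n) r0 => x x0; field.
    by rewrite !gt_eqF//; nra.
  rewrite ler_pM2r//; apply: ler_pM.
  - by rewrite sqr_ge0.
  - by rewrite invr_ge0 mulr_ge0// sqr_ge0.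
  - by rewrite ler_pXn2r ?nnegrE//; lra.
  - rewrite lef_pV2 ?posrE ?mulr_gt0 ?exprn_gt0//; try lra.
    rewrite ler_pM2l// ler_pXn2r ?nnegrE//; lra.
apply: le_trans (ewens_var_le n tn) _.
have -> : n%:R ^+ 2 / theta n = r n ^+ 2 * theta n.
  rewrite nE; move: (r n) => x; field; exact: lt0r_neq0.
by rewrite ler_pM2r// ler_pXn2r ?nnegrE//; lra.
Unshelve. all: by end_near. Qed.

(** Eventually [n < theta n], so the denominator in [ewens_var_ge] is at most
    [4 * (2 * theta n) ^+ 2], whence 16. *)
Lemma caseC1_var : caseC1 theta ->
  \forall n \near \oo, 16^-1 * (n%:R ^+ 2 / theta n) <= v n <=
    1 * (n%:R ^+ 2 / theta n).
Proof.
move=> [rc _]; near=> n.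
have n1 : (1 < n)%N by near: n; exact: nbhs_infty_gt.
have tn := theta_gt0 (ltnW n1).
have nt : n%:R < theta n.
  by rewrite -[ltRHS]mul1r -ltr_pdivrMr//; near: n; apply: (cvgr_lt 0).
apply/andP; split; last by rewrite mul1r; exact: ewens_var_le.
apply: le_trans (ewens_var_ge tn n1).
have n0 : 0 <= n%:R :> R by [].
have -> : 16^-1 * (n%:R ^+ 2 / theta n) =
    theta n * n%:R ^+ 2 / (4 * (theta n + theta n) ^+ 2).
  by field; rewrite !gt_eqF// addr_gt0.
rewrite ler_wpM2l ?mulr_ge0 ?sqr_ge0 ?(ltW tn)//.
rewrite lef_pV2 ?posrE ?mulr_gt0 ?exprn_gt0//; try lra.
rewrite ler_pM2l// ler_pXn2r ?nnegrE//; lra.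
Unshelve. all: by end_near. Qed.

End regimes.

Theorem corollary2p5 (R : realType) (theta : nat -> R)
  (theta_gt0 : forall n : nat, (0 < n)%N -> 0 < theta n)
  (theta_nd : forall m n : nat, (0 < m)%N -> (m <= n)%N -> theta m <= theta n)
  (d : nat -> measure_display) (T : forall n : nat, measurableType (d n))
  (P : forall n : nat, probability (T n) R)
  (K : forall n : nat, {RV (P n) >-> R})
  (K_law : forall n : nat, (0 < n)%N -> ewens_K_law n (theta n) (K n)) :
  let dist (n : nat) : R :=
    sup_norm (fun x : R => standardized_cdf (K n) x - std_normal_cdf x) in
  [/\ caseA theta ->
        asymp dist (fun n => 1 / Num.sqrt (theta n * ln (n%:R / theta n))),
      caseBstar theta ->
        asymp dist (fun n => 1 / Num.sqrt (theta n)) &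
      caseC1 theta ->
        asymp dist (fun n => 1 / Num.sqrt (n%:R ^+ 2 / theta n))].
Proof.
move=> dist.
have p1 : 0 < normal_pdf 0 1 1 :> R by exact: normal_pdf01_gt0.
have l0 : 0 < normal_pdf 0 1 1 / 4 :> R by rewrite divr_gt0.
have u0 : 0 < (normal_pdf 0 1 1)^-1 + 5 :> R by rewrite addr_gt0 ?invr_gt0.
have bnd : \forall n \near \oo, 1 <= ber_var (ewens_probs (theta n) n) ->
    normal_pdf 0 1 1 / 4 * (Num.sqrt (ber_var (ewens_probs (theta n) n)))^-1
    <= dist n <=
    ((normal_pdf 0 1 1)^-1 + 5) * (Num.sqrt (ber_var (ewens_probs (theta n) n)))^-1.
  near=> n; have n0 : (0 < n)%N by near: n; exact: nbhs_infty_gt.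
  exact: sup_norm_ewens_bounds (theta_gt0 _ n0) (K_law _ n0).
split.
- move=> /(caseA_var theta_gt0 theta_nd)[boo vb].
  exact: (asymp_inv_sqrt l0 u0 _ _ bnd boo vb).
- move=> [c [c0 _]] /(caseB_var theta_gt0 c0)[boo vb].
  apply: (asymp_inv_sqrt l0 u0 _ _ bnd boo vb).
    by rewrite divr_gt0 ?mulr_gt0 ?exprn_gt0//; lra.
  by rewrite exprn_gt0//; lra.
- move=> hC; have [_ boo] := hC.
  exact: (asymp_inv_sqrt l0 u0 _ _ bnd boo (caseC1_var theta_gt0 hC)).
Unshelve. all: by end_near. Qed.
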